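(* For every integer $n\ge 1$, the free group $\mathbb{F}_n$ of rank $n$ enjoys property NINF: every non-trivial normal subgroup of infinite index in $\mathbb{F}_n$ is not finitely generated.
   Context: A group $G$ satisfies property NINF if every normal non-trivial subgroup $K$ of $G$ of infinite index is not finitely generated. *)

(* Defs.v *)
From HB Require Import structures.
From mathcomp Require Import all_boot.
From mathcomp Require Import boolp classical_sets cardinality.

Set Implicit Arguments.
Unset Strict Implicit.
Unset Printing Implicit Defensive.

Local Open Scope group_scope.
Local Open Scope classical_set_scope.

Section Groups.
Variable G : groupType.
Implicit Types (K A : set G) (x y : G).

Definition is_subgroup K : Prop :=
  [/\ K 1, forall x y, K x -> K y -> K (x * y) & forall x, K x -> K x^-1].

Definition is_normal_subgroup K : Prop :=
  is_subgroup K /\ forall x y, K x -> K (x ^ y).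

Definition generated A : set G := smallest is_subgroup A.

Definition finitely_generated K : Prop :=
  exists2 A : set G, finite_set A & K = generated A.

Definition left_coset K x : set G := [set x * k | k in K].

Definition infinite_index K : Prop := infinite_set (range (left_coset K)).

End Groups.

Definition NINF (G : groupType) : Prop :=
  forall K : set G, is_normal_subgroup K -> K <> [set 1] ->
    infinite_index K -> ~ finitely_generated K.

(* The free group on an alphabet T, as the set of reduced words.  The letter  *)
(* (t, false) stands for the generator t and (t, true) for its inverse.       *)

Section ReducedWords.
Variable T : choiceType.
Implicit Types (a b : T * bool) (s u v w : seq (T * bool)).

Definition inv_letter a : T * bool := (a.1, ~~ a.2).

Definition reduced s : bool := sorted (fun a b => b != inv_letter a) s.

(* The reduced form of a :: s when s is reduced. *)
Definition cons_letter a s :=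
  if s is b :: s' then if b == inv_letter a then s' else a :: s else [:: a].

(* The reduced form of u ++ v when v is reduced. *)
Definition word_mul u v := foldr cons_letter v u.

Definition word_inv s := rev (map inv_letter s).

Lemma inv_letterK : involutive inv_letter.
Proof. by case=> t e; rewrite /inv_letter /= negbK. Qed.

Lemma reduced_behead a s : reduced (a :: s) -> reduced s.
Proof. exact: path_sorted. Qed.

Lemma reduced_cons_letter a s : reduced s -> reduced (cons_letter a s).
Proof.
case: s => [|b s] //= rs; case: eqP => [_|/eqP nba]; first exact: reduced_behead rs.
by rewrite /reduced /= nba.
Qed.

Lemma reduced_word_mul u v : reduced v -> reduced (word_mul u v).
Proof. by move=> rv; elim: u => //= a u; apply: reduced_cons_letter. Qed.

Lemma reduced_word_inv s : reduced s -> reduced (word_inv s).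
Proof.
rewrite /reduced /word_inv rev_sorted sorted_map.
apply: sub_sorted => a b /=; apply: contra_neq => /(congr1 inv_letter).
by rewrite !inv_letterK => ->; rewrite inv_letterK.
Qed.

Lemma cons_letterK a s : reduced s ->
  cons_letter (inv_letter a) (cons_letter a s) = s.
Proof.
case: s => [|b s] /= rs; first by rewrite inv_letterK eqxx.
case: eqP => [eb|nb] /=; last by rewrite inv_letterK eqxx.
case: s rs => [|c s] /=; first by rewrite -eb.
by rewrite /reduced /= => /andP[/negPf ncb _]; rewrite -eb ncb.
Qed.

Lemma word_mul_cons_letter a u v : reduced v ->
  word_mul (cons_letter a u) v = cons_letter a (word_mul u v).
Proof.
case: u => [|b u] //= rv; case: eqP => [->|//] /=.
have /(cons_letterK (inv_letter a)) := reduced_word_mul u rv.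
by rewrite inv_letterK => ->.
Qed.

Lemma word_mulA u v w : reduced w ->
  word_mul u (word_mul v w) = word_mul (word_mul u v) w.
Proof. by move=> rw; elim: u => //= a u ->; rewrite word_mul_cons_letter. Qed.

Lemma word_mul_reduced s : reduced s -> word_mul s [::] = s.
Proof.
elim: s => //= a s IHs ras; rewrite IHs ?(reduced_behead ras) //.
by case: s ras {IHs} => //= b s /andP[/negPf-> _].
Qed.

Lemma word_invK s : word_inv (word_inv s) = s.
Proof. by rewrite /word_inv map_rev revK mapK //; apply: inv_letterK. Qed.

Lemma word_mulVw s : word_mul (word_inv s) s = [::].
Proof.
elim: s => //= a s IHs; rewrite /word_inv /word_mul /= rev_cons foldr_rcons /=.
by rewrite inv_letterK eqxx.
Qed.

Record free_group : predArgType :=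
  FreeGroup { word :> seq (T * bool); word_reduced : reduced word }.

HB.instance Definition _ := [isSub for word].
HB.instance Definition _ := [Choice of free_group by <:].

Implicit Types x y z : free_group.

Definition fg_one := @FreeGroup [::] isT.
Definition fg_mul x y := FreeGroup (reduced_word_mul x (word_reduced y)).
Definition fg_inv x := FreeGroup (reduced_word_inv (word_reduced x)).

Lemma fg_mulA : associative fg_mul.
Proof. by move=> x y z; apply/val_inj/word_mulA/word_reduced. Qed.

Lemma fg_mul1g : left_id fg_one fg_mul.
Proof. by move=> x; apply/val_inj. Qed.

Lemma fg_mulg1 : right_id fg_one fg_mul.
Proof. by move=> x; apply/val_inj/word_mul_reduced/word_reduced. Qed.

Lemma fg_mulVg : left_inverse fg_one fg_inv fg_mul.
Proof. by move=> x; apply/val_inj/word_mulVw. Qed.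

Lemma fg_mulgV : right_inverse fg_one fg_inv fg_mul.
Proof.
by move=> x; apply/val_inj; rewrite /= -{1}(word_invK x); apply: word_mulVw.
Qed.

HB.instance Definition _ :=
  isGroup.Build free_group fg_mulA fg_mul1g fg_mulg1 fg_mulVg fg_mulgV.

Definition fg_gen (t : T) : free_group := @FreeGroup [:: (t, false)] isT.

End ReducedWords.

Section UniversalProperty.
Variables (T : choiceType) (H : groupType) (f : T -> H).

Definition eval_letter (a : T * bool) : H := if a.2 then (f a.1)^-1 else f a.1.

Definition fg_lift (x : free_group T) : H := \prod_(a <- word x) eval_letter a.

Lemma fg_lift_gen t : fg_lift (fg_gen t) = f t.
Proof. by rewrite /fg_lift big_seq1. Qed.

Lemma fg_liftM x y : fg_lift (x * y) = fg_lift x * fg_lift y.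
Proof.
rewrite /fg_lift; case: x => u /= _; elim: u => [|a u IHu] /=.
  by rewrite big_nil mul1g.
rewrite big_cons -mulgA -IHu; case: (word_mul u y) => [|b w] /=.
  by rewrite big_seq1 big_nil mulg1.
case: eqP => [->|_]; rewrite !big_cons //.
by case: a => t []; rewrite /eval_letter /= ?mulVKg ?mulKg ?mulgA ?mulVg ?mulgV ?mul1g.
Qed.

Lemma fg_lift_unique (g : free_group T -> H) :
  {morph g : x y / x * y} -> (forall t, g (fg_gen t) = f t) -> g =1 fg_lift.
Proof.
move=> gM gf.
have g1 : g 1 = 1 by apply: (mulgI (g 1)); rewrite -gM !mulg1.
have gV x : g x^-1 = (g x)^-1.
  by apply: (mulgI (g x)); rewrite -gM !mulgV.
case=> u ru; elim: u ru => [|a u IHu] rau.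
  rewrite /fg_lift big_nil -[RHS]g1; congr g; exact: val_inj.
have -> : FreeGroup rau =
    @FreeGroup T [:: a] isT * FreeGroup (reduced_behead rau).
  by apply: val_inj => /=; case: u rau {IHu} => //= b s /andP[/negPf-> _].
rewrite gM IHu fg_liftM; congr (_ * _); rewrite /fg_lift big_seq1.
case: a {rau} => t [] /=; rewrite /eval_letter /= -gf // -gV.
by congr g; apply: val_inj.
Qed.

End UniversalProperty.

(* Main.v *)
Require Import Defs.
From mathcomp Require Import all_boot.
From mathcomp Require Import boolp classical_sets cardinality.

Set Implicit Arguments.
Unset Strict Implicit.
Unset Printing Implicit Defensive.

(** Let [K] be normal and generated by a finite set [A], and let [S] be the
    union of the cosets [K q], for [q] a prefix of [1] or of an element of [A].
    Then [S] meets finitely many cosets and is closed under taking prefixes.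
    Let [h x] be the longest prefix of [x] lying in [S]; it satisfies
    [h (k * x) = k * h x] for [k] in [K].  If [K] has infinite index then,
    given [k0] in [K], some [g] is such that [g * r] is outside [S] for every
    prefix [r] of [k0]; the path from [g] to [g * k0] in the Cayley tree then
    avoids [S], so [h (g * k0) = h g].  As
    [h (g * k0) = h ((g * k0 * g^-1) * g) = (g * k0 * g^-1) * h g], it follows
    that [k0 = 1]. *)

(** * Prefixes of reduced words as geodesics in the Cayley tree *)

Section Prefixes.
Local Open Scope group_scope.
Local Open Scope classical_set_scope.
Variable T : choiceType.
Implicit Types (a b : T * bool) (p q u v : seq (T * bool)).
Implicit Types (x y z s t : free_group T).

Lemma reduced_prefix p u : prefix p u -> reduced u -> reduced p.
Proof. by case/prefixP=> v ->; rewrite /reduced => /cat_sorted2[]. Qed.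

Lemma cons_letter_reduced a u : reduced (a :: u) -> cons_letter a u = a :: u.
Proof. by case: u => //= b u /andP[/negPf->]. Qed.

Lemma word_mul_cat u v : reduced (u ++ v) -> word_mul u v = u ++ v.
Proof.
elim: u => //= a u IHu rau.
by rewrite IHu ?(reduced_behead rau) // cons_letter_reduced.
Qed.

(** Triangles in the Cayley tree are tripods: the side from [1] to the product is covered by the
    other two sides. *)
Lemma prefix_word_mul p u v : reduced u -> reduced v ->
  prefix p (word_mul u v) ->
  prefix p u \/ exists2 q, prefix q v & p = word_mul u q.
Proof.
move=> + rv; elim: u p => [|a u IHu] p rau /=; first by right; exists p.
have ru := reduced_behead rau.
have rm := reduced_word_mul u rv.
have [[w ew]|nc] := pselect (exists w, word_mul u v = inv_letter a :: w).
  rewrite ew /= eqxx => pw.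
  (* Restoring the cancelled letter in front of [p] makes the induction hypothesis apply; [u] cannot
     start with [inv_letter a], as [a :: u] is reduced. *)
  have pm : prefix (inv_letter a :: p) (word_mul u v) by rewrite ew /= eqxx.
  case: (IHu _ ru pm) => [pu|[q qv eq]].
    by case: u rau pu {IHu ru rm ew pm} => //= b u /andP[/negPf nb _]; rewrite eq_sym nb.
  by right; exists q => //; rewrite -eq /= eqxx.
have -> : cons_letter a (word_mul u v) = a :: word_mul u v.
  case: (word_mul u v) nc => //= b w nc; case: eqP => // eb.
  by case: nc; exists w; rewrite eb.
case: p => [_|b p]; first by left.
rewrite /= => /andP[/eqP-> pm].
case: (IHu _ ru pm) => [pu|[q qv eq]]; first by left; rewrite eqxx.
right; exists q => //; rewrite -eq.
case: p pm {eq} => //= c p; case: eqP => // -> pm; case: nc.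
by case: (word_mul u v) pm => //= d w /andP[/eqP<- _]; exists w.
Qed.

Definition fg_prefix x y : bool := prefix (word x) (word y).

Lemma fg_prefix_refl x : fg_prefix x x.
Proof. exact: prefix_refl. Qed.

Lemma fg_prefix_trans y x z : fg_prefix x y -> fg_prefix y z -> fg_prefix x z.
Proof. exact: prefix_trans. Qed.

Lemma fg_prefix1 x : fg_prefix 1 x.
Proof. exact: prefix0s. Qed.

Lemma fg_prefix_antisym x y : fg_prefix x y -> fg_prefix y x -> x = y.
Proof.
move=> /prefixP[u eu] /prefixP[v ev]; apply: val_inj => /=.
move: (congr1 size ev); rewrite eu !size_cat -addnA -[LHS]addn0 => /eqP.
by rewrite eqn_add2l eq_sym addn_eq0 => /andP[/nilP-> _]; rewrite cats0.
Qed.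

Lemma fg_prefix_cat x y : fg_prefix x y ->
  word y = word x ++ word (x^-1 * y).
Proof.
case/prefixP=> u eu.
have ru : reduced u.
  by have := word_reduced y; rewrite eu /reduced => /cat_sorted2[].
suff -> : y = x * FreeGroup ru by rewrite mulKg /= word_mul_cat // -eu word_reduced.
by apply: val_inj => /=; rewrite word_mul_cat // -eu word_reduced.
Qed.

Lemma fg_prefixM s x y : fg_prefix s (x * y) ->
  fg_prefix s x \/ exists2 t, fg_prefix t y & s = x * t.
Proof.
case/(prefix_word_mul (word_reduced x) (word_reduced y)) => [|[q qy es]].
  by left.
right; exists (FreeGroup (reduced_prefix qy (word_reduced y))) => //.
exact: val_inj.
Qed.

Lemma fg_prefix_mull s t x : fg_prefix s x -> fg_prefix t (s^-1 * x) ->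
  fg_prefix s (s * t) /\ fg_prefix (s * t) x.
Proof.
move=> /fg_prefix_cat ex /prefixP[u eu].
have rx := word_reduced x.
rewrite /fg_prefix ex eu catA in rx *.
by rewrite /= word_mul_cat ?prefix_prefix ?(reduced_prefix (prefix_prefix _ _) rx).
Qed.

(** Inversion reverses words, so multiplying [y] by a prefix of its inverse deletes final letters of
    [y]. *)
Lemma fg_prefixV x y : fg_prefix x y^-1 -> fg_prefix (y * x) y.
Proof.
rewrite -{2 3}[y]invgK; move: y^-1 => {}y /fg_prefix_cat ey.
have -> : y^-1 * x = (x^-1 * y)^-1 by rewrite invgM invgK.
rewrite /fg_prefix [word y^-1]/(word_inv (word y)) ey.
by rewrite /word_inv map_cat rev_cat prefix_prefix.
Qed.

(** The tripod property for [x = (x * y) * y^-1], the path back from [x * y] to [x] being read in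
    the opposite direction. *)
Lemma fg_prefix_mulr s x y : fg_prefix s x ->
  fg_prefix s (x * y) \/ exists2 t, fg_prefix t y & s = x * t.
Proof.
rewrite -{1}[x](mulgK y) => /fg_prefixM[|[t ty es]]; first by left.
by right; exists (y * t); [exact: fg_prefixV | rewrite mulgA].
Qed.

Lemma fg_prefix_or_cancel x y :
  fg_prefix x (x * y) \/
  exists t, [/\ t <> 1, fg_prefix t y & fg_prefix (x * t) x].
Proof.
case: x y => u ru [v rv]; rewrite /fg_prefix /=.
case: v rv => [|a v] rv; first by left; rewrite word_mul_reduced ?prefix_refl.
case/lastP: u ru => [|u b] ru; first by left.
have [eab|nab] := eqVneq a (inv_letter b).
  (* The witness is the first letter of [y], which cancels the last letter of [x]. *)
  right; exists (@FreeGroup T [:: a] isT); split=> //=.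
    by rewrite eqxx; exact: prefix0s.
  rewrite /word_mul foldr_rcons /= eab eqxx -/(word_mul _ _).
  rewrite word_mul_reduced ?prefix_rcons //.
  exact: reduced_prefix (prefix_rcons _ _) ru.
left; rewrite word_mul_cat ?prefix_prefix //.
move: ru rv; rewrite /reduced; case: u => [|c u] /=; first by rewrite nab.
by rewrite cat_path last_rcons /= nab => -> ->.
Qed.

Lemma finite_fg_prefix x : finite_set [set y | fg_prefix y x].
Proof.
(* A prefix is determined by its length. Since [take] keeps a word reduced, the default [1] of
   [insubd] is never returned. *)
apply: (@sub_finite_set _ _
  ((fun i => insubd (1 : free_group T) (take i (word x))) @` `I_(size (word x)).+1)).
  move=> y /= yx; exists (size (word y)).
    by rewrite /= ltnS; exact: size_prefix.
  apply: val_inj; rewrite /= val_insubd.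
  by move/prefixP: yx => [u ->]; rewrite take_size_cat // word_reduced.
exact: finite_image.
Qed.

End Prefixes.

(** * The longest prefix in a set, and its behaviour under translation *)

Section LongestPrefix.
Local Open Scope group_scope.
Local Open Scope classical_set_scope.
Variables (T : choiceType) (S : set (free_group T)).
Implicit Types (k s t x y : free_group T).

(** Maximality refers to the prefix order rather than to length, so that uniqueness is
    antisymmetry. *)
Definition longest_prefix x s : Prop :=
  [/\ S s, fg_prefix s x & forall y, fg_prefix y x -> S y -> fg_prefix y s].

Lemma longest_prefix_unique x s t :
  longest_prefix x s -> longest_prefix x t -> s = t.
Proof.
by move=> [Ss sx hs] [St tx ht]; apply: fg_prefix_antisym; [apply: ht | apply: hs].
Qed.

(** The prefixes of [x] form a chain ordered by length, so one of maximal length in [S] is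
    greatest. *)
Lemma longest_prefix_exists x : S 1 -> exists s, longest_prefix x s.
Proof.
move=> S1.
pose P i := `[< exists y, [/\ S y, fg_prefix y x & size (word y) = i] >].
have exP : exists i, P i by exists 0; apply/asboolP; exists 1; rewrite fg_prefix1.
have bP i : P i -> i <= size (word x).
  by move=> /asboolP[y [_ yx <-]]; exact: size_prefix.
case: (ex_maxnP exP bP) => i /asboolP[s [Ss sx <-]] max; exists s; split=> // y yx Sy.
have le : size (word y) <= size (word s).
  by apply: max; apply/asboolP; exists y.
move/prefixP: sx => [u eu]; move/prefixP: yx => [v ev].
have -> : fg_prefix y s = prefix (word y) (take (size (word s)) (word x)).
  by rewrite eu take_size_cat.
by rewrite ev take_cat ltnNge le /= prefix_prefix.
Qed.

(** The points [x * r] form the path from [x] to [x * y]; as it avoids [S], it neither removes [s]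
    nor adds a longer candidate. *)
Lemma longest_prefix_mulr x y s : longest_prefix x s ->
  (forall r, fg_prefix r y -> ~ S (x * r)) -> longest_prefix (x * y) s.
Proof.
move=> [Ss sx hs] nS; split=> //.
  case: (fg_prefix_mulr y sx) => // -[t ty es].
  by case: (nS t ty); rewrite -es.
move=> z /fg_prefixM[zx|[t ty ->]]; first exact: hs.
by move=> /(nS t ty).
Qed.

(** By invariance, the path from [k * s] to [k * x] meets [S] only at its start. A cancellation
    between [k * s] and [t] would make this path pass through a proper prefix of [k * s], which is
    in [S] by prefix closure. *)
Lemma longest_prefix_mull k x s :
  (forall y, S (k * y) <-> S y) ->
  (forall y z, fg_prefix y z -> S z -> S y) ->
  longest_prefix x s -> longest_prefix (k * x) (k * s).
Proof.
move=> Sk Sp [Ss sx hs]; set t := s^-1 * x.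
have ex : k * x = k * s * t by rewrite /t mulgA mulgK.
have max r : fg_prefix r t -> S (k * s * r) -> r = 1.
  move=> rt; rewrite -mulgA Sk => Ssr.
  have [ssr srx] := fg_prefix_mull sx rt.
  by apply: (mulgI s); rewrite mulg1; apply: fg_prefix_antisym => //; exact: hs.
have Sks : S (k * s) by rewrite Sk.
rewrite ex; split=> //.
  case: (fg_prefix_or_cancel (k * s) t) => // -[r [r1 rt rks]].
  by case: r1; apply: max => //; exact: Sp rks Sks.
move=> y /fg_prefixM[//|[r rt ->]] /(max _ rt) ->.
by rewrite mulg1 fg_prefix_refl.
Qed.

End LongestPrefix.

(** * The prefix-closed union of cosets attached to a generating set *)

Section FinitelyGenerated.
Local Open Scope group_scope.
Local Open Scope classical_set_scope.
Variables (T : choiceType) (A : set (free_group T)).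
Implicit Types (k q x y : free_group T).

Lemma generated_subgroup : is_subgroup (generated A).
Proof.
split=> [B [[]] //|x y Kx Ky B BA|x Kx B BA]; have [[B1 BM BV] _] := BA.
  by apply: BM; [exact: Kx | exact: Ky].
by apply: BV; exact: Kx.
Qed.

(** Adjoining [1] to [A] keeps this set nonempty when [A] is empty. *)
Definition generator_prefixes : set (free_group T) :=
  \bigcup_(a in 1 |` A) [set q | fg_prefix q a].

(** The set [S] of the overview: the preimage in the Cayley tree of the base point of the Schreier
    graph and of the vertices on the loops labelled by [A]. *)
Definition core : set (free_group T) :=
  [set k * q | k in generated A & q in generator_prefixes].

Lemma generator_prefixes1 : generator_prefixes 1.
Proof. by exists 1; [left | exact: fg_prefix1]. Qed.

Lemma finite_generator_prefixes : finite_set A -> finite_set generator_prefixes.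
Proof.
move=> fA; apply: bigcup_finite => [|a _]; last exact: finite_fg_prefix.
by rewrite finite_setU; split=> //; exact: finite_set1.
Qed.

Lemma core_mull k x : generated A k -> core (k * x) <-> core x.
Proof.
have [K1 KM KV] := generated_subgroup => Kk; split=> -[k' Kk' [q Qq e]].
  exists (k^-1 * k'); first by apply: KM => //; exact: KV.
  by exists q => //; rewrite -mulgA e mulKg.
by exists (k * k'); [exact: KM | exists q; rewrite // -mulgA e].
Qed.

Lemma core_generator_prefixes q : generator_prefixes q -> core q.
Proof.
by move=> Qq; exists 1; [have [] := generated_subgroup | exists q; rewrite ?mul1g].
Qed.

(** The elements of [generated A] with all prefixes in [core] form a subgroup containing [A]:
    products are handled by the tripod property, inverses by reversing paths. *)
Lemma core_prefix_generated k x : generated A k -> fg_prefix x k -> core x.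
Proof.
pose C : set (free_group T) :=
  [set k | generated A k /\ forall x, fg_prefix x k -> core x].
have [K1 KM KV] := generated_subgroup.
suff /(_ k) KC : generated A `<=` C by move=> /KC[_]; apply.
apply: smallest_sub; last first.
  move=> a Aa; split; first exact: sub_gen_smallest.
  by move=> y ya; apply: core_generator_prefixes; exists a; [right|].
split=> [|x1 x2 [K1x C1] [K2x C2]|x1 [K1x C1]].
- split=> // y y1; apply: core_generator_prefixes.
  by exists 1; [left | exact: y1].
- split=> [|y /fg_prefixM[|[t tx ->]]]; [exact: KM | exact: C1 |].
  by rewrite core_mull //; exact: C2.
split=> [|y /fg_prefixV yx]; first exact: KV.
by rewrite -(core_mull _ K1x); exact: C1.
Qed.

Lemma core_prefix x y : fg_prefix x y -> core y -> core x.
Proof.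
move=> + [k Kk [q [a Aa qa] ey]]; rewrite -ey => /fg_prefixM[|[t tq ->]].
  exact: core_prefix_generated.
rewrite core_mull //; apply: core_generator_prefixes.
by exists a => //; exact: fg_prefix_trans tq qa.
Qed.

End FinitelyGenerated.

(** * Normality, infinite index and the conclusion *)

Section NormalSubgroup.
Local Open Scope group_scope.
Local Open Scope classical_set_scope.

(** Since [k * x = x * k ^ x], normality reconciles the cosets [K q] forming [core] with the left
    cosets counted by [infinite_index]. *)
Lemma left_coset_normal (G : groupType) (K : set G) (k x : G) :
  is_normal_subgroup K -> K k -> left_coset K (k * x) = left_coset K x.
Proof.
move=> [[_ KM KV] KJ] Kk; apply/seteqP; split=> y [h Kh <-].
  exists (k ^ x * h); first by apply: KM => //; exact: KJ.
  by rewrite conjgE !mulgA mulgV mul1g.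
exists (k^-1 ^ x * h); first by apply: KM => //; apply: KJ; exact: KV.
by rewrite conjgE !mulgA mulgK mulgV mul1g.
Qed.

(** Otherwise every [g] lies in some [K q r^-1] with [q] in [generator_prefixes A] and [r] a prefix
    of [x], which leaves finitely many cosets. *)
Lemma exists_avoiding_core (T : choiceType) (A : set (free_group T)) x :
  finite_set A -> is_normal_subgroup (generated A) ->
  infinite_index (generated A) ->
  exists g, forall r, fg_prefix r x -> ~ core A (g * r).
Proof.
move=> fA nK; apply: contra_notP => /forallNP nex.
apply: (@sub_finite_set _ _ [set left_coset (generated A) (q * r^-1)
  | q in generator_prefixes A & r in [set r | fg_prefix r x]]); last first.
  apply: finite_image2; first exact: finite_generator_prefixes.
  exact: finite_fg_prefix.
move=> _ [g _ <-]; have /existsNP[r /not_implyP[rx /contrapT [k Kk [q Qq e]]]] := nex g.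
exists q => //; exists r => //.
by rewrite -(left_coset_normal _ nK Kk) mulgA e mulgK.
Qed.

Lemma free_group_NINF (T : choiceType) : NINF (free_group T).
Proof.
move=> K nK K1 iK [A fA eK]; move: nK K1 iK; rewrite {K}eK => nK + iK; apply.
have [KS KJ] := nK; have [K1 _ _] := KS.
apply/seteqP; split=> [k Kk|_ -> //].
have [g hg] := exists_avoiding_core k fA nK iK.
have S1 := core_generator_prefixes (generator_prefixes1 A).
have [s gs] := longest_prefix_exists g S1.
have Kgk : generated A (k ^ g^-1) by exact: KJ.
have := longest_prefix_mull (fun y => core_mull y Kgk) (@core_prefix _ A) gs.
have -> : k ^ g^-1 * g = g * k by rewrite conjgE invgK mulgA mulgVK.
(* Both [s] and [k ^ g^-1 * s] are the longest prefix of [g * k] in the core, so [k ^ g^-1 = 1]. *)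
move=> /(longest_prefix_unique (longest_prefix_mulr gs hg)) /esym.
rewrite -[RHS]mul1g => /mulIg /(congr1 (fun x => x ^ g)).
by rewrite conjgKV conj1g.
Qed.

End NormalSubgroup.

Theorem lemma3p3 (n : nat) (hn : 1 <= n) : NINF (free_group 'I_n).
Proof. exact: free_group_NINF. Qed.
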